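(* Let $n\geq 1$. For $1\leq r\leq n$, the exterior power $\Lambda^r(\mathbb C^n)$ is a projective indecomposable $\mathbb C\mathfrak T_n$-module with radical $\operatorname{rad}(\Lambda^r(\mathbb C^n))=\Lambda^r(\mathrm{Aug}(\mathbb C^n))$ and simple top (isomorphic to) $\Lambda^{r-1}(\mathrm{Aug}(\mathbb C^n))$.
   Context: $\mathfrak T_n$ is the monoid of all self-maps of $[n]=\{1,\ldots,n\}$ under composition. All modules are left modules. $\mathbb C^n$ is the natural $\mathbb C\mathfrak T_n$-module: $fv_i=v_{f(i)}$ for $f\in\mathfrak T_n$, where $v_1,\ldots,v_n$ is the standard basis; $\mathrm{Aug}(\mathbb C^n)=\{(x_1,\ldots,x_n)\in\mathbb C^n\mid x_1+\cdots+x_n=0\}$ is its augmentation submodule. Exterior powers are over $\mathbb C$, with $f(u_1\wedge\cdots\wedge u_k)=fu_1\wedge\cdots\wedge fu_k$ for $f\in\mathfrak T_n$ (and trivial action on $\Lambda^0=\mathbb C$); $\Lambda^r(\mathrm{Aug}(\mathbb C^n))$ is regarded as a submodule of $\Lambda^r(\mathbb C^n)$. The top of a module $P$ is $P/\operatorname{rad}(P)$. *)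

(* Defs.v *)
From HB Require Import structures.
From mathcomp Require Import all_boot all_order all_algebra.
From mathcomp Require Import generic_quotient ring_quotient.
From mathcomp Require Import boolp reals complex.
From mathcomp.multinomials Require Import freeg.

Set Implicit Arguments.
Unset Strict Implicit.
Unset Printing Implicit Defensive.

Import GRing.Theory.
Local Open Scope ring_scope.
Local Open Scope quotient_scope.

(* -------------------------------------------------------------------- *)
Section Submodules.
Variables (A : pzRingType) (V : lmodType A).

Definition submod_gen (S : V -> Prop) : {pred V} :=
  fun x => `[< forall U : submodClosed V, (forall s, S s -> s \in U) -> x \in U >].

Lemma submod_genP (S : V -> Prop) x :
  reflect (forall U : submodClosed V, (forall s, S s -> s \in U) -> x \in U)
          (x \in submod_gen S).
Proof. exact: asboolP. Qed.

Fact submod_gen_closed S : submod_closed (submod_gen S).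
Proof.
split=> [|a x y /submod_genP Sx /submod_genP Sy]; apply/submod_genP => U SU.
  exact: rpred0.
by apply: rpredD; [apply: rpredZ; apply: Sx | apply: Sy].
Qed.
HB.instance Definition _ S :=
  GRing.isSubmodClosed.Build A V (submod_gen S) (submod_gen_closed S).

Lemma mem_submod_gen (S : V -> Prop) x : S x -> x \in submod_gen S.
Proof. by move=> Sx; apply/submod_genP => U; apply. Qed.

Definition maximal_submod (U : submodClosed V) : Prop :=
  (exists x, x \notin U) /\
  forall W : submodClosed V, {subset U <= W} -> W =i U \/ W =i predT.

Definition radical : {pred V} :=
  fun x => `[< forall U : submodClosed V, maximal_submod U -> x \in U >].

Lemma radicalP x :
  reflect (forall U : submodClosed V, maximal_submod U -> x \in U)
          (x \in radical).
Proof. exact: asboolP. Qed.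

Fact radical_closed : submod_closed radical.
Proof.
split=> [|a x y /radicalP Rx /radicalP Ry]; apply/radicalP => U mU.
  exact: rpred0.
by apply: rpredD; [apply: rpredZ; apply: Rx | apply: Ry].
Qed.
HB.instance Definition _ :=
  GRing.isSubmodClosed.Build A V radical radical_closed.

Definition simple_module : Prop :=
  (exists x : V, x != 0) /\
  forall U : submodClosed V, (forall x, x \in U -> x = 0) \/ U =i predT.

Definition indecomposable : Prop :=
  (exists x : V, x != 0) /\
  forall U W : submodClosed V,
    (forall x, x \in U -> x \in W -> x = 0) ->
    (forall x, exists u w, [/\ u \in U, w \in W & x = u + w]) ->
    (forall x, x \in U -> x = 0) \/ (forall x, x \in W -> x = 0).

Definition projective : Prop :=
  forall (M N : lmodType A) (g : {linear M -> N}) (f : {linear V -> N}),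
    (forall y, exists x, g x = y) ->
    exists h : {linear V -> M}, forall x, g (h x) = f x.

End Submodules.

Arguments radical {A} V.
Arguments simple_module {A} V.
Arguments indecomposable {A} V.
Arguments projective {A} V.

Definition isomorphic (A : pzRingType) (V W : lmodType A) : Prop :=
  exists f : {linear V -> W}, bijective f.

(* -------------------------------------------------------------------- *)
Section QuotientModule.
Variables (A : pzRingType) (V : lmodType A) (U : submodClosed V).

(* [submodClosed] does not inherit from the [zmodClosed] expected by
   [Quotient.quot]. *)
Definition submod_zmod : {pred V} := fun x => x \in U.

Fact submod_zmod_closed : zmod_closed submod_zmod.
Proof. exact: GRing.submod_closedB (submodClosedP U). Qed.
HB.instance Definition _ :=
  GRing.isZmodClosed.Build V submod_zmod submod_zmod_closed.

Definition quotmod : Type := Quotient.quot submod_zmod.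

HB.instance Definition _ := GRing.Zmodule.on quotmod.

Definition qpi (x : V) : quotmod := \pi_(Quotient.quot submod_zmod) x.
Definition qrepr (y : quotmod) : V := repr (y : Quotient.quot submod_zmod).

Lemma qreprK y : qpi (qrepr y) = y.
Proof. exact: reprK. Qed.

Lemma qpi_eq x y : qpi x = qpi y <-> x - y \in U.
Proof.
have -> : (x - y \in U) = (x - y \in submod_zmod) by [].
rewrite Quotient.idealrBE; split=> [|/eqP]; last by [].
by move=> E; apply/eqP.
Qed.

Fact qpi_is_zmod_morphism : zmod_morphism qpi.
Proof. by move=> x y; rewrite /qpi !piE. Qed.
HB.instance Definition _ :=
  GRing.isZmodMorphism.Build V quotmod qpi qpi_is_zmod_morphism.

Definition qscale (a : A) (y : quotmod) : quotmod := qpi (a *: qrepr y).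

Lemma qscaleE a x : qscale a (qpi x) = qpi (a *: x).
Proof. by apply/qpi_eq; rewrite -scalerBr rpredZ //; apply/qpi_eq/qreprK. Qed.

Fact qscaleA a b y : qscale a (qscale b y) = qscale (a * b) y.
Proof. by rewrite -(qreprK y) !qscaleE scalerA. Qed.
Fact qscale1 : left_id 1 qscale.
Proof. by move=> y; rewrite -(qreprK y) !qscaleE scale1r. Qed.
Fact qscaleDr : right_distributive qscale +%R.
Proof.
move=> a x y.
by rewrite -(qreprK x) -(qreprK y) -raddfD !qscaleE -raddfD scalerDr.
Qed.
Fact qscaleDl y : {morph qscale^~ y : a b / a + b}.
Proof. by move=> a b; rewrite -(qreprK y) !qscaleE -raddfD scalerDl. Qed.
HB.instance Definition _ := GRing.Zmodule_isLmodule.Build A quotmod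
  qscaleA qscale1 qscaleDr qscaleDl.

Fact qpi_is_scalable : scalable qpi.
Proof. by move=> a x; rewrite -qscaleE. Qed.
HB.instance Definition _ :=
  GRing.isScalable.Build A V quotmod *:%R qpi qpi_is_scalable.

Lemma qpi_eq0 x : qpi x = 0 <-> x \in U.
Proof. by rewrite -(raddf0 qpi) qpi_eq subr0. Qed.

Section Lift.
Variables (W : lmodType A) (f : {linear V -> W}).

Definition qlift (y : quotmod) : W := f (qrepr y).

Hypothesis fU : forall x, x \in U -> f x = 0.

Lemma qliftE x : qlift (qpi x) = f x.
Proof.
apply/subr0_eq; rewrite /qlift -linearB.
exact/fU/qpi_eq/qreprK.
Qed.

Lemma qlift_is_linear : linear qlift.
Proof.
move=> a x y; rewrite -(qreprK x) -(qreprK y) -linearP.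
by rewrite !qliftE linearP.
Qed.
End Lift.

End QuotientModule.

Definition top (A : pzRingType) (V : lmodType A) : lmodType A :=
  quotmod (radical V).

(* -------------------------------------------------------------------- *)
Section FreeModule.
Variables (F : fieldType) (K : choiceType).

Definition freemod : Type := {freeg K / F}.
HB.instance Definition _ := GRing.Lmodule.on freemod.

Definition fgen (x : K) : freemod := << x >>.

Lemma freemod_sumE (D : freemod) :
  D = \sum_(x <- dom D) coeff x D *: fgen x.
Proof.
rewrite -[LHS]freeg_sumE; apply: eq_bigr => x _.
by apply/eqP/freeg_eqP => y; rewrite coeffZ !coeffU mul1r.
Qed.

Lemma freemod_linear_ext (W : lmodType F) (f g : {linear freemod -> W}) :
  (forall x, f (fgen x) = g (fgen x)) -> f =1 g.
Proof.
move=> fg D; rewrite [D]freemod_sumE !raddf_sum; apply: eq_bigr => x _.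
by rewrite /= !linearZ /= fg.
Qed.

Section Lift.
Variables (W : lmodType F) (f : K -> W).

Definition free_lift : freemod -> W := fglift f.

Lemma free_lift_gen x : free_lift (fgen x) = f x.
Proof. by rewrite /free_lift liftU scale1r. Qed.

Fact free_lift_is_zmod_morphism : zmod_morphism free_lift.
Proof. exact: lift_is_additive. Qed.
HB.instance Definition _ :=
  GRing.isZmodMorphism.Build freemod W free_lift free_lift_is_zmod_morphism.

Fact free_lift_is_scalable : scalable free_lift.
Proof.
move=> a D /=; rewrite [D]freemod_sumE scaler_sumr.
rewrite !(raddf_sum free_lift) scaler_sumr; apply: eq_bigr => x _ /=.
have E b : b *: fgen x = << b *g x >> :> freemod.
  by apply/eqP/freeg_eqP => y; rewrite coeffZ !coeffU mul1r.
by rewrite scalerA !E /free_lift !liftU scalerA.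
Qed.
HB.instance Definition _ :=
  GRing.isScalable.Build F freemod W *:%R free_lift free_lift_is_scalable.

End Lift.
End FreeModule.

(* -------------------------------------------------------------------- *)
Section ExteriorPower.
Variables (F : fieldType) (r : nat).

Section Construction.
Variable V : lmodType F.

Definition subst_at (u : {ffun 'I_r -> V}) (i : 'I_r) (x : V) :
  {ffun 'I_r -> V} := [ffun j => if j == i then x else u j].

Inductive ext_rel : freemod F {ffun 'I_r -> V} -> Prop :=
| ExtLinear (u : {ffun 'I_r -> V}) i a x y :
    ext_rel (fgen F (subst_at u i (a *: x + y))
             - (a *: fgen F (subst_at u i x) + fgen F (subst_at u i y)))
| ExtAlternating (u : {ffun 'I_r -> V}) i j :
    i != j -> u i = u j -> ext_rel (fgen F u).

(* The r-th exterior power: formal linear combinations of r-tuples of vectors,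
   modulo the relations that make the class of the tuple multilinear and
   alternating; for r = 0 there is a single tuple and no relation. *)
Definition ext : Type := quotmod (submod_gen ext_rel).
HB.instance Definition _ := GRing.Lmodule.on ext.

Definition wedge (u : {ffun 'I_r -> V}) : ext := qpi _ (fgen F u).

Definition multilinear (W : lmodType F) (m : {ffun 'I_r -> V} -> W) : Prop :=
  forall u i a x y, m (subst_at u i (a *: x + y)) =
                    a *: m (subst_at u i x) + m (subst_at u i y).

Definition alternating (W : lmodType F) (m : {ffun 'I_r -> V} -> W) : Prop :=
  forall (u : {ffun 'I_r -> V}) i j, i != j -> u i = u j -> m u = 0.

Lemma wedge_multilinear : multilinear wedge.
Proof.
move=> u i a x y; apply/eqP; rewrite -subr_eq0 /wedge.
rewrite -linearP -raddfB; apply/eqP/qpi_eq0/mem_submod_gen.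
exact: ExtLinear.
Qed.

Lemma wedge_alternating : alternating wedge.
Proof.
by move=> u i j ij uij; apply/qpi_eq0/mem_submod_gen; apply: ExtAlternating uij.
Qed.

Lemma ext_linear_ext (W : lmodType F) (f g : {linear ext -> W}) :
  (forall u, f (wedge u) = g (wedge u)) -> f =1 g.
Proof.
move=> fg y; rewrite -(qreprK y).
pose p : {linear (freemod F {ffun 'I_r -> V}) -> ext} :=
  qpi (submod_gen ext_rel).
exact: (@freemod_linear_ext _ _ _ (f \o p) (g \o p) fg).
Qed.

Definition ext_lift (W : lmodType F) (m : {ffun 'I_r -> V} -> W) : ext -> W :=
  qlift (free_lift m).

Section ExtLift.
Variables (W : lmodType F) (m : {ffun 'I_r -> V} -> W).
Hypotheses (ml : multilinear m) (ma : alternating m).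

Lemma ext_lift_rel x : x \in submod_gen ext_rel -> free_lift m x = 0.
Proof.
pose k : {pred freemod F {ffun 'I_r -> V}} := fun x => free_lift m x == 0.
have k_closed : submod_closed k.
  split=> [|a y z]; rewrite !unfold_in ?raddf0 // => /eqP my /eqP mz.
  by rewrite linearP /= my mz scaler0 addr0.
pose kS := GRing.isSubmodClosed.Build _ _ k k_closed.
pose K : submodClosed _ := HB.pack k kS.
move/submod_genP/(_ K) => H; apply/eqP; apply: H => {x} _ [u i a x y|u i j ij uij].
  rewrite unfold_in /= raddfB raddfD /= linearZ /= !free_lift_gen.
  by rewrite ml subrr.
by rewrite unfold_in /= free_lift_gen (ma ij uij).
Qed.

Lemma ext_lift_wedge u : ext_lift m (wedge u) = m u.
Proof. by rewrite /ext_lift (qliftE ext_lift_rel) /= free_lift_gen. Qed.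

Lemma ext_lift_is_linear : linear (ext_lift m).
Proof. exact: qlift_is_linear ext_lift_rel. Qed.
End ExtLift.

End Construction.

Section Functoriality.
Variables (V W : lmodType F) (g : {linear V -> W}).

Definition wedge_map (u : {ffun 'I_r -> V}) : ext W :=
  wedge [ffun i => g (u i)].

Definition ext_map : ext V -> ext W := ext_lift wedge_map.

Fact wedge_map_multilinear : multilinear wedge_map.
Proof.
move=> u i a x y.
have E z : wedge_map (subst_at u i z) =
           wedge (subst_at [ffun j => g (u j)] i (g z)).
  by congr wedge; apply/ffunP => j; rewrite !ffunE; case: ifP.
by rewrite !E linearP wedge_multilinear.
Qed.

Fact wedge_map_alternating : alternating wedge_map.
Proof.
move=> u i j ij uij; apply: (wedge_alternating ij).
by rewrite !ffunE uij.
Qed.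

Lemma ext_map_wedge u : ext_map (wedge u) = wedge [ffun i => g (u i)].
Proof.
exact: ext_lift_wedge wedge_map_multilinear wedge_map_alternating u.
Qed.

Fact ext_map_is_linear : linear ext_map.
Proof.
exact: ext_lift_is_linear wedge_map_multilinear wedge_map_alternating.
Qed.
HB.instance Definition _ :=
  GRing.isLinear.Build F (ext V) (ext W) *:%R ext_map ext_map_is_linear.

End Functoriality.

Lemma ext_map_id (V : lmodType F) (g : {linear V -> V}) :
  g =1 id -> ext_map g =1 id.
Proof.
move=> gid; apply: (@ext_linear_ext _ _ (ext_map g) idfun) => u.
by rewrite /= ext_map_wedge; congr wedge; apply/ffunP => i; rewrite ffunE gid.
Qed.

Lemma ext_map_comp (V W X : lmodType F) (g : {linear V -> W})
    (h : {linear W -> X}) (k : {linear V -> X}) :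
  (forall x, k x = h (g x)) -> forall y, ext_map k y = ext_map h (ext_map g y).
Proof.
move=> kE; apply: (@ext_linear_ext _ _ (ext_map k) (ext_map h \o ext_map g)) => u.
rewrite /= !ext_map_wedge; congr wedge.
by apply/ffunP => i; rewrite !ffunE kE.
Qed.

End ExteriorPower.

Arguments ext {F} r V.
Arguments ext_map {F} r {V W} g.

(* -------------------------------------------------------------------- *)
Section FullTransformationMonoid.
Variable n : nat.

Definition transf : Type := {ffun 'I_n -> 'I_n}.
HB.instance Definition _ := Finite.on transf.

Definition transf_mul (f g : transf) : transf := [ffun i => f (g i)].
Definition transf_one : transf := [ffun i => i].

Fact transf_mulA : associative transf_mul.
Proof. by move=> f g h; apply/ffunP => i; rewrite !ffunE. Qed.
Fact transf_mul1 : left_id transf_one transf_mul.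
Proof. by move=> f; apply/ffunP => i; rewrite !ffunE. Qed.
Fact transf_mulr1 : right_id transf_one transf_mul.
Proof. by move=> f; apply/ffunP => i; rewrite !ffunE. Qed.
HB.instance Definition _ :=
  isMonoid.Build transf transf_mulA transf_mul1 transf_mulr1.

Lemma transf_mulE (f g : transf) i : (f * g)%g i = f (g i).
Proof. by rewrite [LHS]ffunE. Qed.

Lemma transf_oneE i : (1%g : transf) i = i.
Proof. by rewrite [LHS]ffunE. Qed.

End FullTransformationMonoid.

(* -------------------------------------------------------------------- *)
Section MonoidAlgebra.
Variables (F : fieldType) (n : nat).

(* The element \sum_f a f * f of the monoid algebra is encoded as the function
   a; the product is convolution. *)
Definition talg : Type := {ffun transf n -> F}.
HB.instance Definition _ := GRing.Lmodule.copy talg {ffun transf n -> F^o}.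

Definition tbasis (f : transf n) : talg := [ffun g => (g == f)%:R].

Definition talg_ext (W : lmodType F) (t : transf n -> W) (a : talg) : W :=
  \sum_f a f *: t f.

Definition talg_mul (a b : talg) : talg :=
  \sum_f \sum_g (a f * b g) *: tbasis (f * g)%g.

Fact talg_ext_is_linear (W : lmodType F) (t : transf n -> W) :
  linear (talg_ext t).
Proof.
move=> c a b; rewrite /talg_ext scaler_sumr -big_split; apply: eq_bigr => f _.
by rewrite !ffunE scalerDl scalerA.
Qed.
HB.instance Definition _ (W : lmodType F) (t : transf n -> W) :=
  GRing.isLinear.Build F talg W *:%R (talg_ext t) (talg_ext_is_linear t).

Lemma talg_ext_basis (W : lmodType F) (t : transf n -> W) f :
  talg_ext t (tbasis f) = t f.
Proof.
rewrite /talg_ext (bigD1 f) //= big1 => [|g gf].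
  by rewrite ffunE eqxx scale1r addr0.
by rewrite ffunE (negPf gf) scale0r.
Qed.

Lemma talg_sumE (a : talg) : \sum_f a f *: tbasis f = a.
Proof.
apply/ffunP => g; rewrite sum_ffunE (bigD1 g) //= big1 => [|f fg].
  by rewrite !ffunE eqxx addr0 [_ *: _]mulr1.
by rewrite !ffunE eq_sym (negPf fg) [_ *: _]mulr0.
Qed.

Lemma talg_ext_mul (W : lmodType F) (t : transf n -> W) a b :
  talg_ext t (talg_mul a b) =
  \sum_f \sum_g (a f * b g) *: t (f * g)%g.
Proof.
rewrite raddf_sum; apply: eq_bigr => f _; rewrite raddf_sum.
by apply: eq_bigr => g _; rewrite /= linearZ /= talg_ext_basis.
Qed.

Lemma talg_mulEl a b :
  talg_mul a b = talg_ext (fun f => talg_ext (fun g => tbasis (f * g)%g) b) a.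
Proof.
apply: eq_bigr => f _; rewrite scaler_sumr.
by apply: eq_bigr => g _; rewrite scalerA.
Qed.

Lemma talg_mulEr a b :
  talg_mul a b = talg_ext (fun g => talg_ext (fun f => tbasis (f * g)%g) a) b.
Proof.
rewrite /talg_mul exchange_big; apply: eq_bigr => f _; rewrite scaler_sumr.
by apply: eq_bigr => g _; rewrite scalerA mulrC.
Qed.

Fact talg_mulA : associative talg_mul.
Proof.
move=> a b c; rewrite talg_mulEl [RHS]talg_mulEl talg_ext_mul.
apply: eq_bigr => f _; rewrite talg_ext_mul scaler_sumr.
apply: eq_bigr => g _; rewrite -scalerA; congr (_ *: _); rewrite !scaler_sumr.
by apply: eq_bigr => h _; rewrite scalerA mulgA.
Qed.

Fact talg_mul1 : left_id (tbasis 1%g) talg_mul.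
Proof.
move=> a; rewrite talg_mulEl talg_ext_basis -[RHS]talg_sumE.
by apply: eq_bigr => g _; rewrite mul1g.
Qed.

Fact talg_mulr1 : right_id (tbasis 1%g) talg_mul.
Proof.
move=> a; rewrite talg_mulEr talg_ext_basis -[RHS]talg_sumE.
by apply: eq_bigr => g _; rewrite mulg1.
Qed.

Fact talg_mulDl : left_distributive talg_mul +%R.
Proof. by move=> a b c; rewrite !talg_mulEl linearD. Qed.

Fact talg_mulDr : right_distributive talg_mul +%R.
Proof. by move=> a b c; rewrite !talg_mulEr linearD. Qed.

Fact talg_oner_neq0 : tbasis 1%g != 0.
Proof.
apply/eqP => /ffunP/(_ 1%g); rewrite !ffunE eqxx => /eqP.
by rewrite oner_eq0.
Qed.

HB.instance Definition _ := GRing.Zmodule_isNzRing.Build talg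
  talg_mulA talg_mul1 talg_mulr1 talg_mulDl talg_mulDr talg_oner_neq0.

Lemma tbasisM f g : tbasis f * tbasis g = tbasis (f * g)%g.
Proof. by rewrite [LHS]talg_mulEl !talg_ext_basis. Qed.

End MonoidAlgebra.

(* -------------------------------------------------------------------- *)
Section Representations.
Variables (F : fieldType) (n : nat).

(* An F-vector space with a linear left action of the monoid. *)
Record trep := TRep {
  trep_space :> lmodType F;
  tact : transf n -> {linear trep_space -> trep_space};
  tact1 : forall x, tact 1%g x = x;
  tactM : forall f g x, tact (f * g)%g x = tact f (tact g x)
}.

(* The same object seen as a left module over the monoid algebra; the alias
   keeps the two scalar multiplications apart. *)
Definition tmod (X : trep) : Type := trep_space X.

Section TMod.
Variable X : trep.

HB.instance Definition _ := GRing.Zmodule.copy (tmod X) (trep_space X).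

Definition tmod_scale (a : talg F n) (x : tmod X) : tmod X :=
  \sum_f a f *: tact X f x.

Let tmod_scaleE a (x : tmod X) :
  tmod_scale a x = talg_ext (fun f => tact X f x) a.
Proof. by []. Qed.

Fact tmod_scaleA a b x : tmod_scale a (tmod_scale b x) = tmod_scale (a * b) x.
Proof.
rewrite [RHS]talg_ext_mul; apply: eq_bigr => f _.
rewrite raddf_sum scaler_sumr; apply: eq_bigr => g _.
by rewrite /= linearZ /= scalerA tactM.
Qed.

Fact tmod_scale1 : left_id 1 tmod_scale.
Proof. by move=> x; rewrite tmod_scaleE talg_ext_basis tact1. Qed.

Fact tmod_scaleDr : right_distributive tmod_scale +%R.
Proof.
move=> a x y; rewrite /tmod_scale -big_split; apply: eq_bigr => f _.
by rewrite raddfD scalerDr.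
Qed.

Fact tmod_scaleDl x : {morph tmod_scale^~ x : a b / a + b}.
Proof. by move=> a b; rewrite !tmod_scaleE linearD. Qed.

HB.instance Definition _ := GRing.Zmodule_isLmodule.Build (talg F n) (tmod X)
  tmod_scaleA tmod_scale1 tmod_scaleDr tmod_scaleDl.

Lemma tbasis_scale f (x : tmod X) : tbasis F f *: x = tact X f x.
Proof. by rewrite [LHS]talg_ext_basis. Qed.

End TMod.

(* -------------------------------------------------------------------- *)
(* The standard basis vector v_i is [delta_mx i 0]; see [nat_act_delta]. *)
Definition nat_act (f : transf n) (x : 'cV[F]_n) : 'cV[F]_n :=
  \sum_i x i 0 *: delta_mx (f i) 0.

Fact nat_act_is_linear f : linear (nat_act f).
Proof.
move=> a x y; rewrite /nat_act scaler_sumr -big_split; apply: eq_bigr => i _.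
by rewrite !mxE scalerDl scalerA.
Qed.
HB.instance Definition _ f :=
  GRing.isLinear.Build F 'cV[F]_n 'cV[F]_n *:%R (nat_act f)
    (nat_act_is_linear f).

Lemma nat_act_delta f i : nat_act f (delta_mx i 0) = delta_mx (f i) 0.
Proof.
rewrite /nat_act (bigD1 i) //= big1 => [|j ji].
  by rewrite mxE !eqxx scale1r addr0.
by rewrite mxE (negPf ji) scale0r.
Qed.

Lemma cV_sum_delta (x : 'cV[F]_n) : x = \sum_i x i 0 *: delta_mx i 0.
Proof. by rewrite {1}(matrix_sum_delta x); apply: eq_bigr => i _; rewrite big_ord1. Qed.

Fact nat_act1 x : nat_act 1%g x = x.
Proof.
rewrite [RHS]cV_sum_delta; apply: eq_bigr => i _.
by rewrite transf_oneE.
Qed.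

Fact nat_actM f g x : nat_act (f * g)%g x = nat_act f (nat_act g x).
Proof.
rewrite [nat_act g x]/nat_act raddf_sum; apply: eq_bigr => i _.
by rewrite transf_mulE /= linearZ /= nat_act_delta.
Qed.

Definition nat_rep : trep := @TRep 'cV[F]_n nat_act nat_act1 nat_actM.

(* -------------------------------------------------------------------- *)
Definition aug_pred : {pred 'cV[F]_n} := fun x => \sum_i x i 0 == 0.

Fact aug_pred_closed : submod_closed aug_pred.
Proof.
split=> [|a x y]; rewrite !unfold_in.
  by rewrite big1 // => i _; rewrite mxE.
move=> /eqP sx /eqP sy; apply/eqP.
under eq_bigr do rewrite !mxE.
by rewrite big_split /= -mulr_sumr sx sy mulr0 addr0.
Qed.
HB.instance Definition _ :=
  GRing.isSubmodClosed.Build F 'cV[F]_n aug_pred aug_pred_closed.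

Record aug := Aug { aug_val : 'cV[F]_n; _ : aug_val \in aug_pred }.
HB.instance Definition _ := [isSub for aug_val].
HB.instance Definition _ := [Choice of aug by <:].
HB.instance Definition _ := [SubChoice_isSubLmodule of aug by <:].

Fact aug_val_is_linear : linear aug_val.
Proof. by move=> a x y; rewrite -[LHS]/(val _) linearP. Qed.
HB.instance Definition _ :=
  GRing.isLinear.Build F aug 'cV[F]_n *:%R aug_val aug_val_is_linear.

Fact nat_act_aug f x : x \in aug_pred -> nat_act f x \in aug_pred.
Proof.
rewrite !unfold_in => /eqP sx; apply/eqP; rewrite -[RHS]sx.
under eq_bigr do rewrite summxE; rewrite exchange_big; apply: eq_bigr => i _.
rewrite (bigD1 (f i)) //= big1 => [|j ji]; rewrite !mxE.
  by rewrite !eqxx mulr1 addr0.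
by rewrite (negPf ji) mulr0.
Qed.

Definition aug_act (f : transf n) (x : aug) : aug :=
  Aug (nat_act_aug f (valP x)).

Fact aug_act_is_linear f : linear (aug_act f).
Proof.
move=> a x y; apply: val_inj.
by rewrite [RHS]linearP -[LHS]/(nat_act f (aug_val (a *: x + y))) !linearP.
Qed.
HB.instance Definition _ f :=
  GRing.isLinear.Build F aug aug *:%R (aug_act f) (aug_act_is_linear f).

Fact aug_act1 x : aug_act 1%g x = x.
Proof. by apply: val_inj; apply: nat_act1. Qed.

Fact aug_actM f g x : aug_act (f * g)%g x = aug_act f (aug_act g x).
Proof. by apply: val_inj; apply: nat_actM. Qed.

Definition aug_rep : trep := @TRep aug aug_act aug_act1 aug_actM.

(* -------------------------------------------------------------------- *)
Section ExtRep.
Variables (r : nat) (X : trep).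

Definition ext_act (f : transf n) : {linear ext r X -> ext r X} :=
  ext_map r (tact X f).

Fact ext_act1 x : ext_act 1%g x = x.
Proof. by apply: ext_map_id; apply: tact1. Qed.

Fact ext_actM f g x : ext_act (f * g)%g x = ext_act f (ext_act g x).
Proof. by apply: ext_map_comp; apply: tactM. Qed.

Definition ext_rep : trep := TRep ext_act1 ext_actM.

Lemma ext_act_wedge f u : ext_act f (wedge u) = wedge [ffun i => tact X f (u i)].
Proof. exact: ext_map_wedge. Qed.

End ExtRep.

(* -------------------------------------------------------------------- *)
Definition ext_aug_incl (r : nat) : ext r aug -> ext r 'cV[F]_n :=
  ext_map r aug_val.

(* The exterior power of the augmentation submodule, regarded as a subset of
   the exterior power of the natural module. *)
Definition ext_aug (r : nat) : {pred tmod (ext_rep r nat_rep)} :=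
  fun x => `[< exists y : ext r aug, ext_aug_incl y = x >].
Arguments ext_aug : clear implicits.

Lemma ext_augP r (x : tmod (ext_rep r nat_rep)) :
  reflect (exists y : ext r aug, ext_aug_incl y = x) (x \in ext_aug r).
Proof. exact: asboolP. Qed.

Section Retraction.
Hypothesis n_gt0 : (0 < n)%N.

Let i0 : 'I_n := Ordinal n_gt0.
Let retr_val (x : 'cV[F]_n) : 'cV[F]_n :=
  x - (\sum_i x i 0) *: delta_mx i0 0.

Let retr_aug x : retr_val x \in aug_pred.
Proof.
have E : \sum_i (delta_mx i0 0 : 'cV[F]_n) i 0 = 1.
  rewrite (bigD1 i0) //= big1 => [|j ji]; rewrite mxE ?eqxx ?addr0 //.
  by rewrite (negPf ji).
rewrite unfold_in; apply/eqP; under eq_bigr do rewrite 3!mxE.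
by rewrite sumrB -mulr_sumr E mulr1 subrr.
Qed.

Let retr x : aug := Aug (retr_aug x).

Let retr_is_linear : linear retr.
Proof.
move=> a x y; apply: val_inj; rewrite [RHS]linearP /= /retr_val.
under eq_bigr do rewrite !mxE.
rewrite big_split /= -mulr_sumr scalerDl -scalerA scalerBr.
by rewrite addrACA opprD.
Qed.

Lemma ext_aug_incl_inj r : injective (@ext_aug_incl r).
Proof.
pose rl := GRing.isLinear.Build F 'cV[F]_n aug *:%R retr retr_is_linear.
pose R : {linear 'cV[F]_n -> aug} := HB.pack retr rl.
apply: (@can_inj _ _ _ (ext_map r R)) => y.
have RK : forall x, R (aug_val x) = x.
  move=> x; apply: val_inj; rewrite /= /retr_val.
  by have /eqP -> := valP x; rewrite scale0r subr0.
rewrite /ext_aug_incl -(@ext_map_comp _ _ _ _ _ _ R idfun) ?ext_map_id //.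
Qed.
End Retraction.

End Representations.

Arguments tmod {F n} X.
Arguments ext_rep {F n} r X.
Arguments ext_aug F n r : clear implicits.

(* Main.v *)
Require Import Defs.
From HB Require Import structures.
From mathcomp Require Import all_boot all_order all_fingroup all_algebra.
From mathcomp Require Import boolp reals complex.

(* The forms f_0 /\ ... /\ f_s on Lambda^(s+1)(C^n), where f_l is the sum of the
   coordinates of index in the fibre over l of a map f : [n] -> [s+1], satisfy
   f_0 + ... + f_s = sum of all coordinates.  Hence they vanish on
   L = Lambda^(s+1)(Aug), and L turns out to be their common kernel.  If w is the
   wedge of the first s+1 basis vectors and f is seen as an element of T_n, then
   f x = (f_0 /\ ... /\ f_s)(x) w; so a submodule not contained in L contains
   w, which generates the whole module.  Thus L is the largest proper submodule,
   which gives the radical, indecomposability and the simple top; the top is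
   identified through y |-> v_0 /\ y.  For projectivity, antisymmetrizing
   v_a |-> (a map extending a) yields a module map phi to the monoid algebra
   with phi(x) w = x. *)

Set Implicit Arguments.
Unset Strict Implicit.
Unset Printing Implicit Defensive.

Import GRing.Theory.
Local Open Scope ring_scope.

(** * Multilinear and alternating maps *)

Section Alternating.
Variables (F : fieldType) (r : nat) (V W : lmodType F).
Variable m : {ffun 'I_r -> V} -> W.
Hypotheses (ml : multilinear m) (ma : alternating m).

Lemma subst_at_id (u : {ffun 'I_r -> V}) i : subst_at u i (u i) = u.
Proof. by apply/ffunP => j; rewrite ffunE; case: eqP => [->|]. Qed.

Lemma multilinearD u i x y :
  m (subst_at u i (x + y)) = m (subst_at u i x) + m (subst_at u i y).
Proof. by rewrite -[x in LHS]scale1r ml scale1r. Qed.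

Lemma multilinear0 u i : m (subst_at u i 0) = 0.
Proof. by apply: (addIr (m (subst_at u i 0))); rewrite -multilinearD !add0r. Qed.

Lemma multilinear_sum (I : finType) u i (c : I -> F) (e : I -> V) :
  m (subst_at u i (\sum_j c j *: e j)) = \sum_j c j *: m (subst_at u i (e j)).
Proof.
elim/big_rec2: _ => [|j y x _ <-]; first exact: multilinear0.
by rewrite ml.
Qed.

(** Polarization: put [u i + u j] in both positions i and j and expand; the two diagonal terms
    vanish, so the two mixed terms are opposite. *)
Lemma alternating_tperm (u : {ffun 'I_r -> V}) i j :
  i != j -> m [ffun k => u (tperm i j k)] = - m u.
Proof.
move=> ij.
have tE x y : subst_at (subst_at u i x) j y =
    [ffun k => if k == j then y else if k == i then x else u k].
  by apply/ffunP => k; rewrite !ffunE.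
have swap x y : subst_at (subst_at u i x) j y = subst_at (subst_at u j y) i x.
  apply/ffunP => k; rewrite !ffunE.
  by case: (k =P j) => [->|//]; case: eqP => // ji; rewrite -ji eqxx in ij.
have diag x : m (subst_at (subst_at u i x) j x) = 0.
  by apply: (ma ij); rewrite !ffunE !eqxx (negPf ij).
have := diag (u i + u j).
rewrite multilinearD !swap !multilinearD -!swap !diag add0r addr0.
have -> : subst_at (subst_at u i (u i)) j (u j) = u by rewrite !subst_at_id.
move=> /eqP; rewrite addr_eq0 => /eqP E.
rewrite -E; congr (m _).
apply/ffunP => k; rewrite !ffunE; case: tpermP => [->|->|/eqP ki /eqP kj].
- by rewrite (negPf ij) eqxx.
- by rewrite eqxx.
- by rewrite (negPf ki) (negPf kj).
Qed.

Lemma alternating_perm (u : {ffun 'I_r -> V}) (s : 'S_r) :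
  m [ffun k => u (s k)] = (-1) ^+ s *: m u.
Proof.
have [ts -> tsP] := prod_tpermP s; elim: ts tsP u => [_|t ts IH /= /andP[t12 tsP]] u.
  rewrite big_nil odd_perm1 scale1r; congr (m _).
  by apply/ffunP => k; rewrite ffunE perm1.
rewrite big_cons odd_permM odd_tperm t12 signr_addb -scalerA -IH //.
rewrite expr1 scaleN1r -(alternating_tperm _ t12); congr (m _).
by apply/ffunP => k; rewrite !ffunE permM.
Qed.
End Alternating.

(** * Induction principles on exterior powers *)

Section ExtSpan.
Variables (F : fieldType) (r : nat) (V : lmodType F).

Lemma ext_ind_wedge (S : ext r V -> Prop) :
  S 0 -> (forall a x y, S x -> S y -> S (a *: x + y)) ->
  (forall u, S (wedge u)) -> forall x, S x.
Proof.
move=> S0 SP Sw x; rewrite -(qreprK x) [qrepr x]freemod_sumE raddf_sum.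
elim/big_rec: _ => // u y _ Sy; rewrite /= linearZ /=; apply: SP => //; apply: Sw.
Qed.
(** It suffices that [e] spans: the entries of a wedge are expanded over [e] one position at a
    time. *)
Lemma ext_ind_family (I : finType) (e : I -> V) (S : ext r V -> Prop) :
  S 0 -> (forall a x y, S x -> S y -> S (a *: x + y)) ->
  (forall x, exists c : I -> F, x = \sum_i c i *: e i) ->
  (forall b : {ffun 'I_r -> I}, S (wedge [ffun k => e (b k)])) ->
  forall x, S x.
Proof.
move=> S0 SP gen Sb; apply: ext_ind_wedge => // u.
(* Only the positions below [d] remain to be expanded; for [d = r] the condition on [u] is empty. *)
suff H d : forall u : {ffun 'I_r -> V},
    (forall k : 'I_r, (d <= k)%N -> exists i, u k = e i) -> S (wedge u).
  by apply: (H r) => k; rewrite leqNgt ltn_ord.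
elim: d => [|d IH] {}u uP.
  have [b bP] := choice (fun k => uP k (leq0n k)).
  have -> : u = [ffun k => e ([ffun k => b k] k)] by apply/ffunP => k; rewrite !ffunE.
  exact: Sb.
have [dr|rd] := ltnP d r; last first.
  by apply: IH => k /(leq_trans rd); rewrite leqNgt ltn_ord.
have [c cE] := gen (u (Ordinal dr)).
rewrite -(subst_at_id u (Ordinal dr)) cE (multilinear_sum (@wedge_multilinear _ _ _)).
elim/big_rec: _ => // i x _ Sx; apply: SP => //.
apply: IH => k dk; rewrite ffunE; case: eqP => [_|/eqP kd]; first by exists i.
by apply: uP; rewrite ltn_neqAle dk andbT eq_sym.
Qed.
End ExtSpan.

(** * Determinantal forms, coordinates and antisymmetrization *)

Section ExtDet.
Variables (F : fieldType) (n r : nat).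

(* The columns of [C] are r linear forms on F^n; their exterior product is
   a linear form on the r-th exterior power. *)
Definition det_form (C : 'M[F]_(n, r)) (u : {ffun 'I_r -> 'cV[F]_n}) : F^o :=
  \det (\matrix_(k, l) \sum_i u k i 0 * C i l).

Fact det_form_multilinear C : multilinear (det_form C).
Proof.
move=> u i a x y; rewrite -[det_form C (subst_at u i y) in RHS]mul1r.
apply: (@determinant_multilinear _ _ _ _ _ i).
- apply/rowP => l; rewrite !mxE !ffunE eqxx mul1r mulr_sumr -big_split.
  by apply: eq_bigr => j _; rewrite !mxE mulrDl mulrA.
- apply/matrixP => k l; rewrite !mxE; apply: eq_bigr => j _.
  by rewrite !ffunE eq_sym (negPf (neq_lift _ _)).
- apply/matrixP => k l; rewrite !mxE; apply: eq_bigr => j _.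
  by rewrite !ffunE eq_sym (negPf (neq_lift _ _)).
Qed.

Fact det_form_alternating C : alternating (det_form C).
Proof.
move=> u i j ij uij; apply: (determinant_alternate ij) => l.
by rewrite !mxE uij.
Qed.

Definition ext_det (C : 'M[F]_(n, r)) : ext r 'cV[F]_n -> F^o :=
  ext_lift (det_form C).

Fact ext_det_is_linear C : linear (ext_det C).
Proof.
exact: ext_lift_is_linear (det_form_multilinear C) (det_form_alternating C).
Qed.
HB.instance Definition _ C :=
  GRing.isLinear.Build F (ext r 'cV[F]_n) F^o *:%R (ext_det C)
    (ext_det_is_linear C).

Lemma ext_det_wedge C u : ext_det C (wedge u) = det_form C u.
Proof.
exact: ext_lift_wedge (det_form_multilinear C) (det_form_alternating C) u.
Qed.

Definition basis_wedge (b : {ffun 'I_r -> 'I_n}) : ext r 'cV[F]_n :=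
  wedge [ffun k => delta_mx (b k) 0].

Lemma basis_wedge_perm (b : {ffun 'I_r -> 'I_n}) (s : 'S_r) :
  basis_wedge [ffun k => b (s k)] = (-1) ^+ s *: basis_wedge b.
Proof.
rewrite -(alternating_perm (@wedge_multilinear _ _ _) (@wedge_alternating _ _ _)).
by congr wedge; apply/ffunP => k; rewrite !ffunE.
Qed.

Lemma basis_wedge_noninj (b : {ffun 'I_r -> 'I_n}) i j :
  i != j -> b i = b j -> basis_wedge b = 0.
Proof. by move=> ij bij; apply: (wedge_alternating ij); rewrite !ffunE bij. Qed.

Lemma ext_ind_basis (S : ext r 'cV[F]_n -> Prop) :
  S 0 -> (forall a x y, S x -> S y -> S (a *: x + y)) ->
  (forall b, S (basis_wedge b)) -> forall x, S x.
Proof.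
move=> S0 SP; apply: (@ext_ind_family _ _ _ _ (fun i : 'I_n => delta_mx i 0)) => //.
by move=> x; exists (fun i => x i 0); apply: cV_sum_delta.
Qed.

Lemma ext_det_basis C b : ext_det C (basis_wedge b) = \det (\matrix_(k, l) C (b k) l).
Proof.
rewrite ext_det_wedge; congr (\det _); apply/matrixP => k l; rewrite !mxE ffunE.
rewrite (bigD1 (b k)) //= big1 => [|j jb]; rewrite mxE ?eqxx ?mul1r ?addr0 //.
by rewrite (negPf jb) mul0r.
Qed.

(** The exterior product of the coordinate forms of indices a(0), ..., a(r-1). All tuples are
    allowed, not only increasing ones, so each coordinate recurs up to sign. *)
Definition ext_coord (a : {ffun 'I_r -> 'I_n}) : ext r 'cV[F]_n -> F^o :=
  ext_det (\matrix_(i, l) (i == a l)%:R).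
HB.instance Definition _ a := GRing.Linear.on (ext_coord a).

(** Leibniz expansion of the determinants: once the permutations are inverted, the term of [s]
    survives only for the tuple b = a o s. *)
Lemma ext_coord_basis_sum (W : lmodType F) (G : {ffun 'I_r -> 'I_n} -> W)
    (a : {ffun 'I_r -> 'I_n}) :
  \sum_b ext_coord b (basis_wedge a) *: G b =
  \sum_(s : 'S_r) (-1) ^+ s *: G [ffun k => a (s k)].
Proof.
under eq_bigr do rewrite /ext_coord ext_det_basis /determinant scaler_suml.
rewrite exchange_big (reindex_inj invg_inj); apply: eq_bigr => s _ /=.
rewrite (bigD1 [ffun k => a (s k)]) //= [X in _ + X]big1 => [|b ba].
  rewrite big1 => [|k _]; first by rewrite mulr1 addr0 odd_permV.
  by rewrite !mxE ffunE permKV eqxx.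
have /existsP[k kP] : [exists k, b k != a (s k)].
  apply: contraNT ba => /existsPn H; apply/eqP/ffunP => k.
  by rewrite ffunE; apply/eqP/negPn/H.
rewrite (bigD1 (s k)) //= !mxE permK eq_sym (negPf kP) mul0r mulr0 scale0r //.
Qed.

(** The linear map sending a basis wedge to the signed average of [G] over the reorderings of its
    tuple. Going through the coordinates makes it well defined without choosing a basis of the
    exterior power. *)
Definition antisym_ext (W : lmodType F) (G : {ffun 'I_r -> 'I_n} -> W)
    (x : ext r 'cV[F]_n) : W :=
  (r`!)%:R^-1 *: \sum_b ext_coord b x *: G b.

Fact antisym_ext_is_linear (W : lmodType F) (G : {ffun 'I_r -> 'I_n} -> W) :
  linear (antisym_ext G).
Proof.
move=> a x y; rewrite /antisym_ext scalerA mulrC -scalerA -scalerDr; congr (_ *: _).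
rewrite scaler_sumr -big_split; apply: eq_bigr => b _.
by rewrite linearP scalerDl scalerA.
Qed.
HB.instance Definition _ (W : lmodType F) (G : {ffun 'I_r -> 'I_n} -> W) :=
  GRing.isLinear.Build F (ext r 'cV[F]_n) W *:%R (antisym_ext G)
    (antisym_ext_is_linear G).

Lemma antisym_ext_basis (W : lmodType F) (G : {ffun 'I_r -> 'I_n} -> W)
    (a : {ffun 'I_r -> 'I_n}) :
  antisym_ext G (basis_wedge a) =
  (r`!)%:R^-1 *: \sum_(s : 'S_r) (-1) ^+ s *: G [ffun k => a (s k)].
Proof. by rewrite /antisym_ext ext_coord_basis_sum. Qed.

Hypothesis rF : (r`!)%:R != 0 :> F.

Lemma antisym_ext_basis_wedge x : antisym_ext basis_wedge x = x.
Proof.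
move: x; apply: ext_ind_basis => [|c x y xE yE|a]; first by rewrite raddf0.
  by rewrite linearP /= xE yE.
rewrite antisym_ext_basis.
under eq_bigr do rewrite basis_wedge_perm scalerA -signr_addb addbb expr0 scale1r.
by rewrite sumr_const card_Sn -[X in _ *: X]scaler_nat scalerA mulVf // scale1r.
Qed.

(** [antisym_ext basis_wedge] is the identity and sees [x] only through its coordinates. *)
Lemma ext_coord_eq0 x : (forall b, ext_coord b x = 0) -> x = 0.
Proof.
move=> x0; rewrite -(antisym_ext_basis_wedge x) /antisym_ext big1 ?scaler0 // => b _.
by rewrite x0 scale0r.
Qed.

End ExtDet.

(** * The sum of the images of two linear maps *)

Section SumImage.
Variables (F : fieldType) (U U' W : lmodType F).
Variables (f : {linear U -> W}) (g : {linear U' -> W}).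

Definition sum_image (x : W) : Prop := exists y z, x = f y + g z.

Lemma sum_imageP a x x' : sum_image x -> sum_image x' -> sum_image (a *: x + x').
Proof.
move=> [y [z ->]] [y' [z' ->]]; exists (a *: y + y'), (a *: z + z').
by rewrite !linearP scalerDr addrACA.
Qed.

Lemma sum_imagel y : sum_image (f y).
Proof. by exists y, 0; rewrite raddf0 addr0. Qed.

Lemma sum_imager z : sum_image (g z).
Proof. by exists 0, z; rewrite raddf0 add0r. Qed.

Lemma sum_image0 : sum_image 0.
Proof. by rewrite -(raddf0 f); apply: sum_imagel. Qed.

Lemma sum_imageZ a x : sum_image x -> sum_image (a *: x).
Proof. by move=> Sx; rewrite -[a *: x]addr0; apply: sum_imageP sum_image0. Qed.

End SumImage.

(** * Left exterior multiplication y |-> v /\ y *)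

Section ExtCons.
Variables (F : fieldType) (s : nat) (V : lmodType F).

Definition ffun_cons (v : V) (u : {ffun 'I_s -> V}) : {ffun 'I_s.+1 -> V} :=
  [ffun k => oapp u v (unlift ord0 k)].

Lemma ffun_cons0 v u : ffun_cons v u ord0 = v.
Proof. by rewrite ffunE unlift_none. Qed.

Lemma ffun_consS v u k : ffun_cons v u (lift ord0 k) = u k.
Proof. by rewrite ffunE liftK. Qed.

Lemma ffun_consE (u : {ffun 'I_s.+1 -> V}) :
  u = ffun_cons (u ord0) [ffun k => u (lift ord0 k)].
Proof.
by apply/ffunP => k; rewrite ffunE; case: unliftP => [j|] -> //=; rewrite ffunE.
Qed.

Definition wedge_cons (v : V) (u : {ffun 'I_s -> V}) : ext s.+1 V :=
  wedge (ffun_cons v u).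

Fact wedge_cons_multilinear v : multilinear (wedge_cons v).
Proof.
move=> u i a x y.
have E z : wedge_cons v (subst_at u i z) =
           wedge (subst_at (ffun_cons v u) (lift ord0 i) z).
  congr wedge; apply/ffunP => k; rewrite !ffunE.
  case: unliftP => [j|] -> //=.
  by rewrite ffunE (inj_eq lift_inj).
by rewrite !E wedge_multilinear.
Qed.

Fact wedge_cons_alternating v : alternating (wedge_cons v).
Proof.
move=> u i j ij uij; apply: (@wedge_alternating _ _ _ _ (lift ord0 i) (lift ord0 j)).
  by rewrite (inj_eq lift_inj).
by rewrite !ffun_consS.
Qed.

Definition ext_cons (v : V) : ext s V -> ext s.+1 V := ext_lift (wedge_cons v).

Lemma ext_cons_wedge v u : ext_cons v (wedge u) = wedge (ffun_cons v u).
Proof.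
exact: ext_lift_wedge (wedge_cons_multilinear v) (wedge_cons_alternating v) u.
Qed.

Fact ext_cons_is_linear v : linear (ext_cons v).
Proof.
exact: ext_lift_is_linear (wedge_cons_multilinear v) (wedge_cons_alternating v).
Qed.
HB.instance Definition _ v :=
  GRing.isLinear.Build F (ext s V) (ext s.+1 V) *:%R (ext_cons v)
    (ext_cons_is_linear v).

End ExtCons.

(** * The exterior power of Aug as the common kernel of the fibre forms *)

Section AugCriterion.
Variables (F : fieldType) (n s : nat) (i0 : 'I_n).

Fact ext_aug_incl_is_linear r : linear (@ext_aug_incl F n r).
Proof. exact: ext_map_is_linear. Qed.
HB.instance Definition _ r :=
  GRing.isLinear.Build F (ext r (aug F n)) (ext r 'cV[F]_n) *:%R
    (@ext_aug_incl F n r) (@ext_aug_incl_is_linear r).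

Let v0 : 'cV[F]_n := delta_mx i0 0.

Fact delta_sub_aug (i j : 'I_n) :
  (delta_mx i 0 - delta_mx j 0 : 'cV[F]_n) \in @aug_pred F n.
Proof.
rewrite unfold_in; under eq_bigr do rewrite !mxE.
have E k : \sum_i (i == k)%:R = 1 :> F.
  by rewrite (bigD1 k) //= eqxx big1 ?addr0 // => l /negPf ->.
rewrite sumrB; under eq_bigr do rewrite andbT.
by under [X in _ - X]eq_bigr do rewrite andbT; rewrite !E subrr.
Qed.

Definition delta_sub (i j : 'I_n) : aug F n := Aug (delta_sub_aug i j).

(** A spanning family adapted to F^n = F v_0 + Aug: [None] gives v_0, and [Some i] gives v_i - v_0,
    which is 0 for i = [i0]. *)
Let e (o : option 'I_n) : 'cV[F]_n := oapp (fun i => aug_val (delta_sub i i0)) v0 o.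

Let incl_cons : {linear ext s (aug F n) -> ext s.+1 'cV[F]_n} :=
  ext_cons v0 \o @ext_aug_incl F n s.

(** A wedge of members of [e] without v_0 comes from Aug; with one v_0, that factor can be moved to
    the front; with two, the wedge is zero. *)
Lemma ext_aug_decomp (x : ext s.+1 'cV[F]_n) :
  exists y z, x = ext_cons v0 (ext_aug_incl y) + @ext_aug_incl F n s.+1 z.
Proof.
pose S : ext s.+1 'cV[F]_n -> Prop := sum_image incl_cons (@ext_aug_incl F n s.+1).
have S0 : S 0 := sum_image0 _ _.
have SP a y z : S y -> S z -> S (a *: y + z) := @sum_imageP _ _ _ _ _ _ a y z.
suff : S x by [].
move: x; apply: (@ext_ind_family _ _ _ _ e S S0 SP).
(* x = (sum of the x_i) v_0 + sum of the x_i (v_i - v_0). *)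
- move=> x; exists (fun o => oapp (fun i => x i 0) (\sum_i x i 0) o).
  rewrite (bigD1 None) //= (reindex_omap (fun i : 'I_n => Some i) id) => [|[]//].
  rewrite [X in _ + X](eq_bigl xpredT) => [|i]; last by rewrite /= eqxx.
  rewrite scaler_suml -big_split {1}[x]cV_sum_delta.
  by apply: eq_bigr => i _; rewrite /= -scalerDr addrC subrK.
move=> b; case: (pickP (fun k => b k == None)) => [k0 /eqP bk0|bS]; last first.
  (* No entry is [None] here, so the default 0 of [odflt] is never reached. *)
  have -> : wedge [ffun k => e (b k)] =
      ext_aug_incl (wedge [ffun k => odflt 0 (omap (delta_sub^~ i0) (b k))]).
    rewrite /ext_aug_incl ext_map_wedge; congr wedge.
    by apply/ffunP => k; rewrite !ffunE; have := bS k; case: (b k).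
  exact: sum_imager.
(* Exchange positions 0 and [k0], which brings v_0 to the front at the cost of a sign. *)
have <- : [ffun k => [ffun k => e (b (tperm ord0 k0 k))] (tperm ord0 k0 k)] =
    [ffun k => e (b k)] by apply/ffunP => k; rewrite !ffunE tpermK.
rewrite (alternating_perm (@wedge_multilinear _ _ _) (@wedge_alternating _ _ _)).
set u := [ffun k => _]; apply: sum_imageZ.
have u0 : u ord0 = v0 by rewrite ffunE tpermL bk0.
case: (pickP (fun j => b (tperm ord0 k0 (lift ord0 j)) == None)) => [j /eqP bj|bS].
  have -> : wedge u = 0.
    by apply: (wedge_alternating (neq_lift ord0 j)); rewrite u0 ffunE bj.
  exact: S0.
pose w := [ffun j => odflt 0 (omap (delta_sub^~ i0) (b (tperm ord0 k0 (lift ord0 j))))].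
have -> : wedge u = incl_cons (wedge w).
  rewrite /= /ext_aug_incl ext_map_wedge ext_cons_wedge (ffun_consE u) u0.
  congr (wedge (ffun_cons _ _)); apply/ffunP => j; rewrite !ffunE.
  by have := bS j; case: (b _).
exact: sum_imagel.
Qed.

Lemma det_sum_col (M : 'M[F]_s.+1) :
  \det M = \det (\matrix_(k, l) if l == ord0 then \sum_j M k j else M k l).
Proof.
(* Right multiplication by this lower unitriangular matrix adds all the other columns to column
   0. *)
pose T : 'M[F]_s.+1 := \matrix_(k, l) ((l == ord0) || (k == l))%:R.
have -> : \det M = \det (M *m T).
  rewrite det_mulmx [\det T]det_trig ?big1 ?mulr1 // => [k _|].
    by rewrite mxE eqxx orbT.
  apply/is_trig_mxP => k l kl; rewrite mxE.
  by case: eqP => [l0|_]; [rewrite l0 in kl | rewrite -val_eqE /= (ltn_eqF kl)].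
congr (\det _); apply/matrixP => k l; rewrite !mxE.
case: eqP => [->|/eqP/negPf l0].
  by apply: eq_bigr => j _; rewrite mxE eqxx mulr1.
rewrite (bigD1 l) //= big1 => [|j jl]; rewrite mxE l0 ?eqxx ?mulr1 ?addr0 //=.
by rewrite (negPf jl) mulr0.
Qed.

(* The form f_0 /\ ... /\ f_s on the exterior power, with f_l the sum of the
   coordinates of index in f^-1(l). *)
Definition fibre_form (f : 'I_n -> 'I_s.+1) : ext s.+1 'cV[F]_n -> F^o :=
  ext_det (\matrix_(i, l) (f i == l)%:R).
HB.instance Definition _ f := GRing.Linear.on (fibre_form f).

(** The fibres of [f] partition [n], so f_0 + ... + f_s is the sum of all coordinates; it may
    replace f_0 in the determinant. On vectors of Aug this column vanishes. *)
Lemma fibre_form_wedge f u : fibre_form f (wedge u) =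
  \det (\matrix_(k, l) if l == ord0 then \sum_i u k i 0
                       else \sum_i u k i 0 * (f i == l)%:R).
Proof.
rewrite /fibre_form ext_det_wedge /det_form det_sum_col; congr (\det _).
apply/matrixP => k l; rewrite !mxE; case: ifP => _; last first.
  by apply: eq_bigr => i _; rewrite mxE.
under eq_bigr do rewrite mxE.
rewrite exchange_big; apply: eq_bigr => i _; rewrite -mulr_sumr.
rewrite (bigD1 (f i)) //= big1 => [|j jf]; rewrite mxE ?eqxx ?addr0 ?mulr1 //.
by rewrite eq_sym (negPf jf).
Qed.

Lemma sum_aug (x : aug F n) : \sum_i aug_val x i 0 = 0.
Proof. exact/eqP/(valP x). Qed.

Lemma fibre_form_aug f z : fibre_form f (ext_aug_incl z) = 0.
Proof.
move: z; apply: (@ext_linear_ext _ _ _ _ (fibre_form f \o @ext_aug_incl F n s.+1) \0) => u /=.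
rewrite /ext_aug_incl ext_map_wedge fibre_form_wedge (expand_det_col _ ord0).
by rewrite big1 // => k _; rewrite mxE eqxx ffunE sum_aug mul0r.
Qed.

(** The hypothesis makes {a(l)} the fibre over l+1. The column of coordinate sums is then (1, 0,
    ..., 0), and its only cofactor is the coordinate of index [a]. *)
Lemma fibre_form_cons (f : 'I_n -> 'I_s.+1) (a : {ffun 'I_s -> 'I_n}) y :
  (forall i l, (f i == lift ord0 l) = (i == a l)) ->
  fibre_form f (ext_cons v0 (ext_aug_incl y)) = ext_coord a (ext_aug_incl y).
Proof.
move=> fa; move: y.
apply: (@ext_linear_ext _ _ _ _ (fibre_form f \o incl_cons)
         (ext_coord a \o @ext_aug_incl F n s)) => u /=.
rewrite /ext_aug_incl ext_map_wedge ext_cons_wedge fibre_form_wedge.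
rewrite (expand_det_col _ ord0) big_ord_recl big1 => [|k _]; last first.
  rewrite mxE eqxx ffun_consS ffunE sum_aug mul0r //.
rewrite addr0 mxE eqxx ffun_cons0 /cofactor expr0 mul1r.
have -> : \sum_i v0 i 0 = 1.
  by rewrite (bigD1 i0) //= big1 => [|j ji]; rewrite mxE ?eqxx ?addr0 // (negPf ji).
rewrite mul1r /ext_coord ext_det_wedge; congr (\det _); apply/matrixP => k l.
rewrite !mxE -[lift _ _ == _](eq_sym ord0) (negPf (neq_lift _ _)).
by apply: eq_bigr => i _; rewrite ffun_consS mxE fa.
Qed.

Lemma ext_coord_noninj (a : {ffun 'I_s -> 'I_n}) i j (x : ext s 'cV[F]_n) :
  i != j -> a i = a j -> ext_coord a x = 0.
Proof.
move=> ij aij; move: x; apply: (@ext_linear_ext _ _ _ _ (ext_coord a) \0) => u /=.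
rewrite /ext_coord ext_det_wedge /det_form -det_tr.
apply: (determinant_alternate ij) => k; rewrite !mxE.
by apply: eq_bigr => l _; rewrite !mxE aij.
Qed.

Hypothesis sF : (s`!)%:R != 0 :> F.

(** Every coordinate of [y] is zero: for injective [a] it is the value of a fibre form on v_0 /\ y,
    and for the other [a] it vanishes identically. *)
Lemma fibre_forms_cons_eq0 (y : ext s (aug F n)) :
  (forall f, fibre_form f (ext_cons v0 (ext_aug_incl y)) = 0) -> y = 0.
Proof.
move=> y0; apply: (@ext_aug_incl_inj _ _ (leq_ltn_trans (leq0n _) (ltn_ord i0))).
rewrite raddf0; apply: (ext_coord_eq0 sF) => a.
have [/injectiveP a_inj|] := boolP (injectiveb a); last first.
  by case/injectivePn => i [j ij aij]; apply: (ext_coord_noninj _ ij).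
(* This map sends a(l) to l+1 and everything outside the image of [a] to 0. *)
rewrite -(@fibre_form_cons (fun i => oapp (lift ord0) ord0 [pick l | a l == i])) //.
move=> i l; case: pickP => [k /eqP <-|/(_ l) ai]; last first.
  by rewrite (negPf (neq_lift _ _)) eq_sym ai.
by rewrite (inj_eq lift_inj) (inj_eq a_inj).
Qed.

(** Write x = v_0 /\ y + z with z from Aug. The forms kill z, so they all vanish on v_0 /\ y, whence
    y = 0. *)
Lemma ext_aug_fibre_forms (x : ext s.+1 'cV[F]_n) :
  (forall f, fibre_form f x = 0) -> exists z, ext_aug_incl z = x.
Proof.
have [y [z ->]] := ext_aug_decomp x; move=> x0; exists z.
suff -> : y = 0 by rewrite !raddf0 add0r.
apply: fibre_forms_cons_eq0 => f; have := x0 f.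
by rewrite raddfD /= fibre_form_aug addr0.
Qed.

End AugCriterion.

(** * General module theory: projectivity, largest submodules, isomorphisms *)

(** Dual basis criterion with one generator: [phi] splits the map a |-> a w from A onto V. A lift of
    [f] is x |-> phi(x) x0, where [x0] is a preimage of f(w). *)
Lemma projective_dual_basis (A : pzRingType) (V : lmodType A) (w : V) (phi : V -> A) :
  (forall a x y, phi (a *: x + y) = a * phi x + phi y) ->
  (forall x, phi x *: w = x) -> projective V.
Proof.
move=> phiP phiK M N g f g_surj; have [x0 gx0] := g_surj (f w).
pose h x := phi x *: x0.
have hL : linear h by move=> a x y; rewrite /h phiP scalerDl scalerA.
pose hP := GRing.isLinear.Build A V M *:%R h hL.
pose hl : {linear V -> M} := HB.pack h hP.
by exists hl => x; rewrite /= /h linearZ /= gx0 -linearZ phiK.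
Qed.

Section LargestSubmodule.
Variables (A : pzRingType) (V : lmodType A) (L : submodClosed V).
Hypothesis L_proper : exists x, x \notin L.
Hypothesis L_top : forall (U : submodClosed V) x, x \in U -> x \notin L -> U =i predT.

Lemma proper_sub_largest (U : submodClosed V) y : y \notin U -> {subset U <= L}.
Proof.
move=> yU x xU; apply: contraNT yU => xL.
by rewrite (L_top xU xL).
Qed.

(** [L] is itself maximal, and a maximal submodule, being proper, lies in [L] and hence equals
    it. *)
Lemma radical_largest : radical V =i L.
Proof.
move=> x; apply/radicalP/idP => [|xL U [[y yU] U_max]].
  apply; split=> // U LU; have [[y yU]|noU] := pselect (exists y, y \notin U).
    by left=> z; apply/idP/idP; [apply: proper_sub_largest yU _ | apply: LU].
  by right=> z; apply/negPn/negP => zU; apply: noU; exists z.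
have [z zL] := L_proper; have [LU|LT] := U_max L (proper_sub_largest yU).
  by rewrite -LU.
by rewrite LT in zL.
Qed.

(** Two proper summands would both lie in [L], and so would their sum. If one of them is everything,
    the other is zero. *)
Lemma largest_indecomposable : indecomposable V.
Proof.
split=> [|U W UW UWV].
  by have [x xL] := L_proper; exists x; apply: contraNneq xL => ->; apply: rpred0.
have [[y yU]|noU] := pselect (exists y, y \notin U); last first.
  right=> x xW; apply: UW => //; apply/negPn/negP => xU; apply: noU.
  by exists x.
have [[z zW]|noW] := pselect (exists z, z \notin W); last first.
  left=> x xU; apply: UW => //; apply/negPn/negP => xW; apply: noW.
  by exists x.
have [x xL] := L_proper; have [u [w [uU wW xE]]] := UWV x.
case/negP: xL; rewrite xE; apply: rpredD.
  exact: proper_sub_largest yU _ uU.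
exact: proper_sub_largest zW _ wW.
Qed.

(** Pull a submodule of the top back to V: either it has an element outside [L] and is everything,
    or it lies in [L], which is the radical. *)
Lemma largest_simple_top : simple_module (top V).
Proof.
pose q : {linear V -> top V} := qpi (radical V).
split=> [|U].
  have [x xL] := L_proper; exists (q x); apply: contraNneq xL => /qpi_eq0.
  by rewrite radical_largest.
pose K : {pred V} := fun x => q x \in U.
have KE x : (x \in K) = (q x \in U) by [].
have K_closed : submod_closed K.
  split=> [|a x y]; rewrite !KE ?raddf0 ?rpred0 // => xU yU.
  by rewrite linearP /= rpredD // rpredZ.
pose KS := GRing.isSubmodClosed.Build _ _ K K_closed.
pose UK : submodClosed _ := HB.pack K KS.
have [[x [xK xL]]|noK] := pselect (exists x, x \in UK /\ x \notin L).
  by right=> z; rewrite -(qreprK z) -[LHS]/(qrepr z \in UK) (L_top xK xL).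
left=> z zU; rewrite -(qreprK z); apply/qpi_eq0; rewrite radical_largest.
apply/negPn/negP => zL; apply: noK; exists (qrepr z); split=> //.
by rewrite -[_ \in _]/(qpi _ (qrepr z) \in U) qreprK.
Qed.

End LargestSubmodule.

Lemma inj_surj_isomorphic (A : pzRingType) (V W : lmodType A) (f : {linear V -> W}) :
  injective f -> (forall y, exists x, f x = y) -> isomorphic W V.
Proof.
move=> f_inj /choice[g gK]; have fK : cancel f g by move=> x; apply/f_inj/gK.
have gL : linear g by move=> a x y; apply: f_inj; rewrite linearP !gK.
pose gP := GRing.isLinear.Build A W V *:%R g gL.
pose gl : {linear W -> V} := HB.pack g gP.
by exists gl; exists f.
Qed.

(** * Linear extension from the monoid to its algebra *)

Section MonoidAlgebraExtra.
Variables (F : fieldType) (n : nat).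

Lemma tbasis_mulE (f : transf n) (b : talg F n) :
  tbasis F f * b = talg_ext (fun g => tbasis F (f * g)%g) b.
Proof. by rewrite [LHS]talg_mulEl talg_ext_basis. Qed.

Lemma talg_ext_comp (W W' : lmodType F) (g : {linear W -> W'}) (t : transf n -> W) a :
  g (talg_ext t a) = talg_ext (fun f => g (t f)) a.
Proof. by rewrite raddf_sum; apply: eq_bigr => f _; rewrite /= linearZ. Qed.

Lemma talg_extD (W : lmodType F) (t t' : transf n -> W) a :
  talg_ext (fun f => t f + t' f) a = talg_ext t a + talg_ext t' a.
Proof. by rewrite -big_split; apply: eq_bigr => f _; rewrite scalerDr. Qed.

Lemma tmod_scaleE (X : trep F n) (a : talg F n) (x : tmod X) :
  a *: x = talg_ext (fun f => tact X f x) a.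
Proof. by []. Qed.

End MonoidAlgebraExtra.

(** * Projectivity, and the action of maps with image in the first s+1 points *)

Section Module.
Variables (F : fieldType) (n s : nat).
Hypothesis sn : (s < n)%N.
Hypothesis rF : ((s.+1)`!)%:R != 0 :> F.

Local Notation E := (ext s.+1 'cV[F]_n).
Local Notation P := (tmod (ext_rep s.+1 (nat_rep F n))).

Lemma ext_act_basis (f : transf n) (b : {ffun 'I_s.+1 -> 'I_n}) :
  tact (ext_rep s.+1 (nat_rep F n)) f (basis_wedge F b) =
  basis_wedge F [ffun k => f (b k)].
Proof.
rewrite [LHS]ext_act_wedge; congr wedge; apply/ffunP => k.
by rewrite !ffunE /= nat_act_delta.
Qed.

Let iota : {ffun 'I_s.+1 -> 'I_n} := [ffun k => widen_ord sn k].
Let w : P := basis_wedge F iota.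

(** [inord] sends every index above s to 0, so the extension takes the value b(0) there. Being a
    precomposition with a fixed map, it commutes with composing by f on the left. *)
Definition transf_extend (b : {ffun 'I_s.+1 -> 'I_n}) : transf n :=
  [ffun i : 'I_n => b (inord i)].

Definition ext_section : P -> talg F n :=
  antisym_ext (fun b => tbasis F (transf_extend b)).
HB.instance Definition _ := GRing.Linear.on (ext_section : E -> talg F n).

Lemma ext_section_act f (x : E) :
  ext_section (tact (ext_rep s.+1 (nat_rep F n)) f x) = tbasis F f * ext_section x.
Proof.
rewrite tbasis_mulE; move: x; apply: ext_ind_basis => [|a x y xE yE|b].
- by rewrite !raddf0.
- by rewrite !linearP /= xE yE.
rewrite ext_act_basis /ext_section !antisym_ext_basis linearZ /=.
congr (_ *: _); rewrite raddf_sum; apply: eq_bigr => t _.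
rewrite /= linearZ /= talg_ext_basis.
congr (_ *: tbasis F _); apply/ffunP => i.
by rewrite transf_mulE !ffunE.
Qed.

Lemma ext_section_linear (a : talg F n) (x y : P) :
  ext_section (a *: x + y) = a * ext_section x + ext_section y.
Proof.
rewrite [LHS](raddfD (ext_section : {linear E -> talg F n})); congr (_ + _).
rewrite [a * _]talg_mulEl [a *: x]tmod_scaleE.
rewrite [LHS](raddf_sum (ext_section : {linear E -> talg F n})).
apply: eq_bigr => f _; rewrite /= linearZ /=; congr (_ *: _).
by rewrite -tbasis_mulE -ext_section_act.
Qed.

(** [transf_extend b] carries [w] to [basis_wedge b], so the left side is the antisymmetrization of
    [basis_wedge] at [x]. *)
Lemma ext_sectionK (x : P) : ext_section x *: w = x.
Proof.
rewrite -[RHS](antisym_ext_basis_wedge rF) tmod_scaleE /ext_section /antisym_ext.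
rewrite linearZ /=; apply: (congr1 (fun z : E => _ *: z)).
rewrite raddf_sum; apply: eq_bigr => b _; rewrite /= linearZ /= talg_ext_basis.
congr (_ *: _); rewrite [LHS]ext_act_basis; congr basis_wedge.
by apply/ffunP => k; rewrite !ffunE inord_val.
Qed.

Lemma ext_nat_projective : projective P.
Proof. exact: projective_dual_basis ext_section_linear ext_sectionK. Qed.

(** On the basis wedge of [b], both sides depend on the self-map f o b of [s+1]: a permutation gives
    its sign times [w], any other map gives 0. *)
Lemma ext_act_fibre (f : 'I_n -> 'I_s.+1) (x : E) :
  tact (ext_rep s.+1 (nat_rep F n)) [ffun i => widen_ord sn (f i)] x =
  fibre_form f x *: (w : E).
Proof.
move: x; apply: ext_ind_basis => [|a x y xE yE|b].
- by rewrite !raddf0 scale0r.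
- by rewrite !linearP /= xE yE scalerDl scalerA.
rewrite ext_act_basis /fibre_form ext_det_basis.
have [/injectiveP fb_inj|] := boolP (injectiveb [ffun k => f (b k)]).
  rewrite (_ : \matrix_(k, l) _ = perm_mx (perm fb_inj)); last first.
    by apply/matrixP => k l; rewrite !mxE permE ffunE.
  rewrite det_perm; apply: etrans (basis_wedge_perm F iota (perm fb_inj)).
  congr basis_wedge.
  by apply/ffunP => k; rewrite !ffunE permE ffunE.
case/injectivePn => i [j ij]; rewrite !ffunE => fij.
rewrite (basis_wedge_noninj _ ij) ?ffunE ?fij //.
by rewrite (determinant_alternate ij) ?scale0r // => l; rewrite !mxE fij.
Qed.

Lemma ext_aug_act r f (y : ext r (aug F n)) :
  ext_aug_incl (tact (ext_rep r (aug_rep F n)) f y) =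
  tact (ext_rep r (nat_rep F n)) f (ext_aug_incl y).
Proof.
rewrite /= /ext_act /ext_aug_incl.
by rewrite -!(@ext_map_comp _ _ _ _ _ _ _ (nat_act f \o @aug_val F n)).
Qed.

Lemma ext_aug_scale r (a : talg F n) (y : tmod (ext_rep r (aug_rep F n))) :
  ext_aug_incl (a *: y) = a *: (ext_aug_incl y : tmod (ext_rep r (nat_rep F n))).
Proof.
rewrite tmod_scaleE [LHS]raddf_sum; apply: eq_bigr => f _.
by rewrite /= linearZ /= ext_aug_act.
Qed.

Fact ext_aug_closed r : submod_closed (ext_aug F n r).
Proof.
split=> [|a _ _ /ext_augP[x <-] /ext_augP[y <-]]; apply/ext_augP.
  by exists 0; rewrite raddf0.
exists ((a *: (x : tmod (ext_rep r (aug_rep F n)))) + y).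
by rewrite raddfD /= ext_aug_scale.
Qed.
HB.instance Definition _ r :=
  GRing.isSubmodClosed.Build (talg F n) (tmod (ext_rep r (nat_rep F n)))
    (ext_aug F n r) (ext_aug_closed r).

End Module.

(** * Compatibility of v /\ y with linear maps and with addition in v *)

Section ExtConsAction.
Variables (F : fieldType) (s : nat).

Lemma ext_map_cons (V W : lmodType F) (g : {linear V -> W}) v (y : ext s V) :
  ext_map s.+1 g (ext_cons v y) = ext_cons (g v) (ext_map s g y).
Proof.
move: y; apply: (@ext_linear_ext _ _ _ _ (ext_map s.+1 g \o ext_cons v)
                   (ext_cons (g v) \o ext_map s g)) => u /=.
rewrite !ext_map_wedge !ext_cons_wedge ext_map_wedge; congr wedge.
by apply/ffunP => k; rewrite !ffunE; case: unliftP => //= j _; rewrite ffunE.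
Qed.

Lemma ext_consD (V : lmodType F) (v v' : V) (y : ext s V) :
  ext_cons (v + v') y = ext_cons v y + ext_cons v' y.
Proof.
move: y; apply: (@ext_linear_ext _ _ _ _ (ext_cons (v + v'))
                   (ext_cons v \+ ext_cons v')) => u /=.
rewrite !ext_cons_wedge.
(* Seen as a substitution at position 0, the prepended vector falls under multilinearity; the 0 is a
   placeholder. *)
have E x : ffun_cons x u = subst_at (ffun_cons 0 u) ord0 x.
  apply/ffunP => k; rewrite !ffunE.
  by case: unliftP => [j|] ->; rewrite ?eqxx // eq_sym (negPf (neq_lift _ _)).
by rewrite (E (v + v')) (E v) (E v') (multilinearD (@wedge_multilinear _ _ _)).
Qed.

End ExtConsAction.

(** * The largest proper submodule, and identification of the top *)

Section Top.
Variables (F : fieldType) (n s : nat).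
Hypothesis sn : (s < n)%N.
Hypothesis rF : ((s.+1)`!)%:R != 0 :> F.

Local Notation E := (ext s.+1 'cV[F]_n).
Local Notation P := (tmod (ext_rep s.+1 (nat_rep F n))).

Let sF : (s`!)%:R != 0 :> F.
Proof. by move: rF; rewrite factS natrM mulf_eq0 negb_or => /andP[]. Qed.

Let n_gt0 : (0 < n)%N := leq_ltn_trans (leq0n s) sn.
Let i0 : 'I_n := Ordinal n_gt0.

Lemma ext_aug_fibreP (x : P) :
  reflect (forall f, fibre_form f (x : E) = 0) (x \in ext_aug F n s.+1).
Proof.
apply: (iffP idP) => [/ext_augP[z <-] f|x0]; first exact: fibre_form_aug.
exact/ext_augP/(ext_aug_fibre_forms i0 sF).
Qed.

Lemma ext_aug_proper : exists x : P, x \notin ext_aug F n s.+1.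
Proof.
exists (basis_wedge F [ffun k => widen_ord sn k] : E).
(* This map is the identity on the first s+1 indices, so the form takes the value det 1 = 1 on the
   generator. *)
apply/negP => /ext_aug_fibreP /(_ (fun i => inord i)) /eqP.
rewrite /fibre_form ext_det_basis (_ : \matrix_(_, _) _ = 1%:M).
  by rewrite det1 oner_eq0.
by apply/matrixP => k l; rewrite !mxE ffunE /= inord_val.
Qed.

Lemma ext_aug_top (U : submodClosed P) x :
  x \in U -> x \notin ext_aug F n s.+1 -> U =i predT.
Proof.
move=> xU /ext_aug_fibreP/existsNP[f /eqP fx] y.
have wU : (basis_wedge F [ffun k => widen_ord sn k] : P) \in U.
  (* Dividing by the nonzero value of the form makes [a] send [x] exactly to the generator. *)
  pose a : talg F n :=
    ((fibre_form f (x : E))^-1 : F) *: tbasis F [ffun i => widen_ord sn (f i)].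
  have <- : a *: x = (basis_wedge F [ffun k => widen_ord sn k] : P).
    rewrite tmod_scaleE linearZ /= talg_ext_basis.
    have /= -> := ext_act_fibre sn f x.
exact: (@scalerK F E _ fx).
  exact: rpredZ.
by rewrite -(ext_sectionK sn rF y) rpredZ.
Qed.

Definition top_map (y : tmod (ext_rep s (aug_rep F n))) : top P :=
  qpi (radical P) (ext_cons (delta_mx i0 0) (ext_aug_incl y) : P).

(** f v_0 = v_0 + (v_f(0) - v_0) with the second term in Aug. Hence y |-> v_0 /\ y respects the
    action only up to the exterior power of Aug, that is, modulo the radical. *)
Lemma ext_act_cons f (y : ext s (aug F n)) :
  tact (ext_rep s.+1 (nat_rep F n)) f (ext_cons (delta_mx i0 0) (ext_aug_incl y)) =
  ext_cons (delta_mx i0 0) (ext_aug_incl (tact (ext_rep s (aug_rep F n)) f y)) +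
  ext_aug_incl (ext_cons (delta_sub F (f i0) i0) (tact (ext_rep s (aug_rep F n)) f y)).
Proof.
apply: etrans (ext_map_cons _ _ _) _; rewrite /= nat_act_delta.
rewrite [X in _ + X]ext_map_cons /= -ext_consD addrC subrK.
by congr ext_cons; rewrite -ext_aug_act.
Qed.

Lemma ext_cons_scale (a : talg F n) (y : tmod (ext_rep s (aug_rep F n))) :
  a *: (ext_cons (delta_mx i0 0) (ext_aug_incl y) : P) =
  ext_cons (delta_mx i0 0) (ext_aug_incl (a *: y)) +
  ext_aug_incl (talg_ext (fun f => ext_cons (delta_sub F (f i0) i0)
                  (tact (ext_rep s (aug_rep F n)) f y)) a).
Proof.
pose t f := tact (ext_rep s (aug_rep F n)) f y.
pose t' (f : transf n) := ext_cons (delta_sub F (f i0) i0) (t f).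
have E2 : ext_aug_incl (talg_ext t' a) = _ :=
  talg_ext_comp (@ext_aug_incl F n s.+1) t' a.
have E1 : ext_cons (delta_mx i0 0) (ext_aug_incl (a *: y)) = _ :=
  talg_ext_comp (ext_cons (delta_mx i0 0) \o @ext_aug_incl F n s) t a.
rewrite {}E1 {}E2 -talg_extD; apply: eq_bigr => f _.
by apply: (congr1 (fun z : E => a f *: z)); apply: ext_act_cons.
Qed.

Lemma radical_ext_nat : radical P =i ext_aug F n s.+1.
Proof. exact: (radical_largest ext_aug_proper ext_aug_top). Qed.

Fact top_map_linear : linear top_map.
Proof.
move=> a x y; rewrite /top_map.
rewrite (raddfD (@ext_aug_incl F n s)) (raddfD (ext_cons _)) raddfD; congr (_ + _).
rewrite -linearZ; apply/esym/qpi_eq; rewrite radical_ext_nat ext_cons_scale.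
by rewrite addrAC subrr add0r; apply/ext_augP; eexists.
Qed.
HB.instance Definition _ :=
  GRing.isLinear.Build (talg F n) (tmod (ext_rep s (aug_rep F n))) (top P) *:%R
    top_map top_map_linear.

(** If v_0 /\ y lies in the radical, all fibre forms vanish on it, which forces y = 0. *)
Lemma top_map_inj : injective top_map.
Proof.
apply: raddf_inj => y /qpi_eq0; rewrite radical_ext_nat => /ext_aug_fibreP.
exact: fibre_forms_cons_eq0.
Qed.

(** In the decomposition v_0 /\ y + z of a representative, z dies in the top. *)
Lemma top_map_surj x : exists y, top_map y = x.
Proof.
have [y [z xE]] := ext_aug_decomp i0 (qrepr x); exists y.
rewrite -(qreprK x) xE; apply/qpi_eq; rewrite radical_ext_nat.
by rewrite opprD addrA subrr add0r rpredN; apply/ext_augP; exists z.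
Qed.

Lemma top_ext_nat_isomorphic : isomorphic (top P) (tmod (ext_rep s (aug_rep F n))).
Proof. exact: inj_surj_isomorphic top_map_inj top_map_surj. Qed.

End Top.

(** * Specialization to the complex numbers *)

Lemma complex_fact_neq0 (R : realType) k : (k`!)%:R != 0 :> R[i].
Proof. by rewrite Num.Theory.pnatr_eq0 -lt0n fact_gt0. Qed.

Local Close Scope ring_scope.

Theorem corollary3p3 (R : realType) (n r : nat)
    (hn : (1 <= n)%N) (hr : (1 <= r <= n)%N) :
  let P := tmod (ext_rep r (nat_rep R[i] n)) in
  [/\ projective P /\ indecomposable P,
      radical P =i ext_aug R[i] n r,
      simple_module (top P) &
      isomorphic (top P) (tmod (ext_rep r.-1 (aug_rep R[i] n)))].
Proof.
case: r hr => [//|s] /= sn.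
have rF := complex_fact_neq0 R s.+1.
have top_proper := ext_aug_proper sn rF; have top_gen := ext_aug_top sn rF.
split.
- by split; [apply: ext_nat_projective | exact: (largest_indecomposable top_proper top_gen)].
- exact: radical_ext_nat.
- exact: (largest_simple_top top_proper top_gen).
- exact: top_ext_nat_isomorphic.
Qed.
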